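(* There exists a non-convex polyhedron $P \subset \mathbb{R}^3$ whose surface $\partial P$ is isometric to the surface $\partial C$ of a cube $C$ with $\operatorname{vol}(C) < \operatorname{vol}(P)$. Equivalently, for the unit cube $C=[0,1]^3$ there is a non-convex polyhedron $P$ with $\partial P$ isometric to $\partial C$ and $\operatorname{vol}(P) > 1$. *)

(* Defs.v *)
From HB Require Import structures.
From mathcomp Require Import all_boot all_order all_algebra.
From mathcomp Require Import all_classical all_reals all_analysis.
Set Implicit Arguments. Unset Strict Implicit. Unset Printing Implicit Defensive.
Import Order.TTheory GRing.Theory Num.Theory.
Import numFieldNormedType.Exports.
Local Open Scope classical_set_scope.
Local Open Scope ring_scope.

Section Defs.
Variable R : realType.

(* Points of R^3 as triples ((x, y), z); the product topology and the
   product sigma-algebra of the Borel/Lebesgue structures come from the library. *)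
Definition pt := ((R * R) * R)%type.

Definition px (p : pt) : R := p.1.1.
Definition py (p : pt) : R := p.1.2.
Definition pz (p : pt) : R := p.2.

Definition edist (p q : pt) : R :=
  Num.sqrt ((px p - px q) ^+ 2 + (py p - py q) ^+ 2 + (pz p - pz q) ^+ 2).

Definition padd (p q : pt) : pt := ((px p + px q, py p + py q), pz p + pz q).
Definition pscale (a : R) (p : pt) : pt := ((a * px p, a * py p), a * pz p).
Definition psub (p q : pt) : pt := padd p (pscale (-1) q).

Definition convex3 (S : set pt) : Prop :=
  forall p q t, S p -> S q -> 0 <= t <= 1 ->
    S (padd (pscale (1 - t) p) (pscale t q)).

Definition det3 (u v w : pt) : R :=
  px u * (py v * pz w - pz v * py w)
  - py u * (px v * pz w - pz v * px w)
  + pz u * (px v * py w - py v * px w).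

Definition tetra (a b c d : pt) : set pt :=
  [set x | exists la lb lc ld : R,
     [/\ 0 <= la, 0 <= lb, 0 <= lc, 0 <= ld & la + lb + lc + ld = 1] /\
     x = padd (padd (pscale la a) (pscale lb b)) (padd (pscale lc c) (pscale ld d))].

Definition nondegenerate (a b c d : pt) : Prop :=
  det3 (psub b a) (psub c a) (psub d a) != 0.

Definition polyhedron (P : set pt) : Prop :=
  exists s : seq (pt * pt * pt * pt),
    s != [::] /\
    (forall t, t \in s -> nondegenerate t.1.1.1 t.1.1.2 t.1.2 t.2) /\
    P = \bigcup_(t in [set t | t \in s]) tetra t.1.1.1 t.1.1.2 t.1.2 t.2.

Definition bd (P : set pt) : set pt := closure P `\` interior P.

Definition unit_cube : set pt :=
  [set p | 0 <= px p <= 1 /\ 0 <= py p <= 1 /\ 0 <= pz p <= 1].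

Definition curve_length (g : R -> pt) : \bar R :=
  ereal_sup [set l | exists (n : nat) (t : nat -> R),
     [/\ t 0%N = 0, t n = 1, (forall i, (i < n)%N -> t i <= t i.+1) &
        l = ((\sum_(i < n) edist (g (t i)) (g (t i.+1)))%:E)%E]].

Definition intrinsic_dist (S : set pt) (x y : pt) : \bar R :=
  ereal_inf [set curve_length g | g in
    [set g : R -> pt | {within `[0, 1], continuous g} /\
       (forall t, 0 <= t <= 1 -> S (g t)) /\ g 0 = x /\ g 1 = y]].

Definition intrinsically_isometric (S T : set pt) : Prop :=
  exists f : pt -> pt, set_bij S T f /\
    forall x y, S x -> S y -> intrinsic_dist T (f x) (f y) = intrinsic_dist S x y.

Definition vol (A : set pt) : \bar R :=
  (((@lebesgue_measure R) \x (@lebesgue_measure R)) \x (@lebesgue_measure R))%E A.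

End Defs.

(* Main.v *)
Require Import Defs.
From mathcomp Require Import all_boot all_order all_algebra.
From mathcomp Require Import all_classical all_reals all_analysis.
From mathcomp Require Import measurable_realfun ring lra.
Import Order.TTheory GRing.Theory Num.Theory.
Import numFieldNormedType.Exports.
Local Open Scope classical_set_scope.
Local Open Scope ring_scope.

Set Implicit Arguments. Unset Strict Implicit. Unset Printing Implicit Defensive.

(** On each face of the unit cube keep the central square of side 1 - 2 e, and
    push these six squares outwards until the strips of width 2 e folded around
    the cube edges become flat.  At each vertex the rim of the three remaining
    e x e squares then becomes an equilateral triangle of side 2 e, over which
    the squares refold as a pyramid with three right isosceles faces; it is
    erected outwards.  With h = sqrt 2 * e, the body contains the inner cube of
    side 1 - 2 e and a slab of height h on each of its faces, and for e = 1/10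
    these alone have volume (4/5)^3 + 6 h (4/5)^2 > 1.  The dihedral angle
    where a strip meets a pyramid is reflex.

    The map between the two surfaces commutes with the symmetries of the cube, so
    it is computed on the chamber x >= y >= z >= 0 only.  It preserves the
    distance from each point to the nearby ones, because a point close to p lies
    in a common affine piece with p, and this is enough to preserve the lengths
    of curves. *)

(* The library has homonyms that hide these two. *)
Local Notation edist := Defs.edist.
Local Notation nondegenerate := Defs.nondegenerate.

(** * Euclidean distance and the topology of space *)

Section EuclideanDistance.
Context {R : realType}.
Implicit Types (p q r : pt R).

Lemma edist_ge0 p q : 0 <= edist p q.
Proof. exact: sqrtr_ge0. Qed.

Lemma edistxx p : edist p p = 0.
Proof. by rewrite /edist !subrr expr0n /= !addr0 sqrtr0. Qed.

Lemma edistC p q : edist p q = edist q p.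
Proof. by rewrite /edist; congr Num.sqrt; ring. Qed.

Lemma sqr_edist p q :
  edist p q ^+ 2 = (px p - px q) ^+ 2 + (py p - py q) ^+ 2 + (pz p - pz q) ^+ 2.
Proof. by rewrite sqr_sqrtr // !addr_ge0 // sqr_ge0. Qed.

Lemma edist_triangle p q r : edist p r <= edist p q + edist q r.
Proof.
rewrite -(@ler_pXn2r _ 2) ?nnegrE ?addr_ge0 ?edist_ge0 // sqrrD !sqr_edist.
set a := px p - px q; set b := py p - py q; set c := pz p - pz q.
set a' := px q - px r; set b' := py q - py r; set c' := pz q - pz r.
have -> : px p - px r = a + a' by rewrite /a /a'; ring.
have -> : py p - py r = b + b' by rewrite /b /b'; ring.
have -> : pz p - pz r = c + c' by rewrite /c /c'; ring.
have cauchy : a * a' + b * b' + c * c' <= edist p q * edist q r.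
  apply: le_trans (ler_norm _) _.
  rewrite -(@ler_pXn2r _ 2) ?nnegrE ?mulr_ge0 ?edist_ge0 //.
  rewrite exprMn !sqr_edist -/a -/b -/c -/a' -/b' -/c' real_normK ?num_real //.
  rewrite -subr_ge0.
  (* Lagrange's identity: the defect in Cauchy-Schwarz is the squared norm of the cross product. *)
  have -> : (a ^+ 2 + b ^+ 2 + c ^+ 2) * (a' ^+ 2 + b' ^+ 2 + c' ^+ 2)
    - (a * a' + b * b' + c * c') ^+ 2 =
    (a * b' - b * a') ^+ 2 + (a * c' - c * a') ^+ 2 + (b * c' - c * b') ^+ 2.
    by ring.
  by rewrite !addr_ge0 // sqr_ge0.
rewrite mulr2n; lra.
Qed.

Lemma norm_px_le p q : `|px p - px q| <= edist p q.
Proof.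
rewrite -(@ler_pXn2r _ 2) ?nnegrE ?edist_ge0 // sqr_edist real_normK ?num_real //.
by rewrite -addrA lerDl addr_ge0 // sqr_ge0.
Qed.

Lemma norm_py_le p q : `|py p - py q| <= edist p q.
Proof.
rewrite -(@ler_pXn2r _ 2) ?nnegrE ?edist_ge0 // sqr_edist real_normK ?num_real //.
by rewrite addrAC lerDr addr_ge0 // sqr_ge0.
Qed.

Lemma norm_pz_le p q : `|pz p - pz q| <= edist p q.
Proof.
rewrite -(@ler_pXn2r _ 2) ?nnegrE ?edist_ge0 // sqr_edist real_normK ?num_real //.
by rewrite lerDr addr_ge0 // sqr_ge0.
Qed.

Lemma edist_le_norm p q :
  edist p q <= `|px p - px q| + `|py p - py q| + `|pz p - pz q|.
Proof.
rewrite -(@ler_pXn2r _ 2) ?nnegrE ?addr_ge0 ?edist_ge0 ?normr_ge0 // sqr_edist.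
rewrite -(real_normK (num_real (px p - px q))) -(real_normK (num_real (py p - py q))).
rewrite -(real_normK (num_real (pz p - pz q))).
have := normr_ge0 (px p - px q); have := normr_ge0 (py p - py q).
have := normr_ge0 (pz p - pz q).
move: `|px _ - _| `|py _ - _| `|pz _ - _| => a b c; nra.
Qed.

Lemma continuous_px : continuous (@px R).
Proof. by move=> p; apply: (@cvg_comp _ _ _ fst fst); [exact: cvg_fst|exact: cvg_fst]. Qed.

Lemma continuous_py : continuous (@py R).
Proof. by move=> p; apply: (@cvg_comp _ _ _ fst snd); [exact: cvg_fst|exact: cvg_snd]. Qed.

Lemma continuous_pz : continuous (@pz R).
Proof. by move=> p; exact: cvg_snd. Qed.

(** Neighbourhoods come from the product topology while lengths use [edist]; this and [cvg_edist]
    translate between the two. *)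
Lemma near_edist p (e : R) : 0 < e -> \forall q \near p, edist q p < e.
Proof.
move=> e0.
have e3 : 0 < e / 3 by rewrite divr_gt0.
near=> q.
apply: le_lt_trans (edist_le_norm _ _) _.
have : `|px q - px p| < e / 3.
  by near: q; apply: cvgr_distC_lt => //; exact: continuous_px.
have : `|py q - py p| < e / 3.
  by near: q; apply: cvgr_distC_lt => //; exact: continuous_py.
have : `|pz q - pz p| < e / 3.
  by near: q; apply: cvgr_distC_lt => //; exact: continuous_pz.
lra.
Unshelve. all: by end_near. Qed.

Lemma cvg_edist (T : Type) (F : set_system T) (FF : Filter F) (f : T -> pt R) p :
  (forall e, 0 < e -> \forall t \near F, edist (f t) p < e) -> f @ F --> p.
Proof.
move=> H.
have -> : f = fun t => ((px (f t), py (f t)), pz (f t)).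
  by apply/funext => t; case: (f t) => [[]].
case: p H => [[x y] z] H.
apply: (@cvg_pair _ _ _ F (nbhs (x, y)) (nbhs z));
  [apply: (@cvg_pair _ _ _ F (nbhs x) (nbhs y))|];
  apply/cvgrPdist_lt => e e0; near=> t.
- rewrite distrC; apply: le_lt_trans (norm_px_le (f t) (x, y, z)) _.
  by near: t; exact: H.
- rewrite distrC; apply: le_lt_trans (norm_py_le (f t) (x, y, z)) _.
  by near: t; exact: H.
- rewrite distrC; apply: le_lt_trans (norm_pz_le (f t) (x, y, z)) _.
  by near: t; exact: H.
Unshelve. all: by end_near. Qed.

End EuclideanDistance.

(** * Maps that preserve distances to nearby points preserve the intrinsic distance *)

Section LocalIsometry.
Context {R : realType}.
Implicit Types (S T : set (pt R)) (f g : pt R -> pt R) (c : R -> pt R).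

(** Only distances to the centre [p] are compared, not those between two points near [p]: folding
    along a line through [p] changes the latter but keeps the former. *)
Definition locally_isometric S f :=
  forall p, S p -> \forall q \near p, S q -> edist (f q) (f p) = edist q p.

(** Here [l] is the length of a polygon inscribed in [c] between the parameters [a] and [b]; the
    inductive form makes concatenation easy. *)
Inductive chain c (a : R) : R -> R -> Prop :=
| chain_nil : chain c a a 0
| chain_rcons b d l : chain c a b l -> b <= d ->
    chain c a d (l + edist (c b) (c d)).

Lemma chain_le c a b l : chain c a b l -> a <= b.
Proof. by elim=> // b' d l' _ ab bd; exact: le_trans bd. Qed.

Lemma chain_cat c a b d l l' :
  chain c a b l -> chain c b d l' -> chain c a d (l + l').
Proof.
move=> H; elim=> [|x y m _ IH xy]; first by rewrite addr0.
by rewrite addrA; exact: chain_rcons.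
Qed.

Lemma chain_partition c (n : nat) (t : nat -> R) :
  (forall i, (i < n)%N -> t i <= t i.+1) ->
  chain c (t 0%N) (t n) (\sum_(i < n) edist (c (t i)) (c (t i.+1))).
Proof.
elim: n => [_|n IH H]; first by rewrite big_ord0; exact: chain_nil.
rewrite big_ord_recr /=; apply: chain_rcons; last exact: H.
by apply: IH => i /ltnW; exact: H.
Qed.

Lemma partition_chain c a b l : chain c a b l ->
  exists (n : nat) (t : nat -> R),
   [/\ t 0%N = a, t n = b, (forall i, (i < n)%N -> t i <= t i.+1) &
       l = \sum_(i < n) edist (c (t i)) (c (t i.+1))].
Proof.
elim=> [|x y m _ [n [t [t0 tn tle ->]]] xy].
  by exists 0%N, (fun=> a); split=> //; rewrite big_ord0.
exists n.+1, (fun i => if (i <= n)%N then t i else y); split => //=.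
- by rewrite ltnn.
- move=> i; rewrite ltnS => i_n; rewrite i_n; move: i_n.
  rewrite leq_eqVlt => /predU1P[->|lt_in]; first by rewrite ltnn tn.
  by rewrite lt_in; exact: tle.
- rewrite big_ord_recr /= leqnn ltnn tn; congr (_ + _).
  by apply: eq_bigr => i _; rewrite (ltnW (ltn_ord i)) ltn_ord.
Qed.

Lemma curve_lengthE c :
  curve_length c = ereal_sup [set l%:E | l in [set l | chain c 0 1 l]].
Proof.
congr ereal_sup; apply/seteqP; split=> [_ [n [t [t0 tn tle ->]]]|_ [l H <-]].
  by eexists; [rewrite -t0 -tn; exact: chain_partition tle|].
have [n [t [t0 tn tle ->]]] := partition_chain H.
by exists n, t.
Qed.

Lemma locally_isometric_within S f c : locally_isometric S f ->
  {within `[0, 1], continuous c} -> (forall t : R, 0 <= t <= 1 -> S (c t)) ->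
  forall t : R, 0 <= t <= 1 -> \forall u \near within `[0, 1] (nbhs t),
    edist (f (c u)) (f (c t)) = edist (c u) (c t).
Proof.
move=> Sf /subspace_continuousP cc cS t t01.
have /cc H : `[0, 1]%classic t by rewrite /= in_itv.
have H' : nbhs t (fun u => `[0, 1]%classic u -> S (c u) ->
  edist (f (c u)) (f (c t)) = edist (c u) (c t)) := H _ (Sf _ (cS _ t01)).
suff : nbhs t (fun u => `[0, 1]%classic u ->
  edist (f (c u)) (f (c t)) = edist (c u) (c t)) by [].
apply: filterS H' => u H' u01.
by apply: H' => //; apply: cS; move: u01; rewrite /= in_itv.
Qed.

(** Near [t], the distances of [f \o c] to its value at [t] are those of [c], so continuity carries
    over. *)
Lemma locally_isometric_comp S f c : locally_isometric S f ->
  {within `[0, 1], continuous c} -> (forall t : R, 0 <= t <= 1 -> S (c t)) ->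
  {within `[0, 1], continuous (f \o c)}.
Proof.
move=> Sf cc cS; apply/subspace_continuousP => t t01.
have t01' : 0 <= t <= 1 by move: t01; rewrite /= in_itv.
have H := locally_isometric_within Sf cc cS t01'.
move/subspace_continuousP : cc => /(_ t t01) ct.
apply: cvg_edist => e e0; near=> u.
rewrite /= (near H u) //.
by near: u; exact: ct (near_edist _ e0).
Unshelve. all: by end_near. Qed.

(* Supremum argument: the parameters reachable from a form a set that is both
   closed and open to the right in [a, b]. *)
Lemma chain_dominates S f c a b : locally_isometric S f ->
  {within `[0, 1], continuous c} -> (forall t : R, 0 <= t <= 1 -> S (c t)) ->
  0 <= a -> a <= b -> b <= 1 ->
  exists2 l, chain c a b l & edist (f (c a)) (f (c b)) <= l.
Proof.
move=> Sf cc cS a0 ab b1.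
pose E := [set t | a <= t <= b /\
  exists2 l, chain c a t l & edist (f (c a)) (f (c t)) <= l].
have Ea : E a.
  by split; [rewrite lexx|exists 0; [exact: chain_nil|rewrite edistxx]].
have supE : has_sup E by split; [exists a|exists b => t [/andP[]]].
pose m := sup E.
have am : a <= m by apply: ub_le_sup => //; exact: supE.2.
have mb : m <= b by apply: ge_sup; [exists a|move=> t [/andP[]]].
have m01 : 0 <= m <= 1 by rewrite (le_trans a0 am) (le_trans mb b1).
have [d /= d0 H] := locally_isometric_within Sf cc cS m01.
have Hm t : `|m - t| < d -> 0 <= t <= 1 ->
    edist (f (c t)) (f (c m)) = edist (c t) (c m).
  by move=> td t01; apply: H => //; rewrite /= in_itv.
(* Closedness: some element of [E] lies within [d] of the supremum, and one more link reaches
   [m]. *)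
have Em : E m.
  have [t Et tm] := sup_adherent d0 supE.
  have tlem : t <= m by apply: ub_le_sup => //; exact: supE.2.
  case: Et => /andP[at_ tb] [l cl fl].
  split; first by rewrite am mb.
  exists (l + edist (c t) (c m)); first exact: chain_rcons.
  apply: le_trans (edist_triangle _ (f (c t)) _) _.
  rewrite -Hm ?lerD2r ?(le_trans a0 at_) ?(le_trans tb b1) //.
  by rewrite ger0_norm ?subr_ge0 // ltrBlDr -ltrBlDl.
have [mltb|] := ltP m b; last first.
  by move=> bm; case: Em => _; rewrite (@le_anti _ _ b m) // bm mb.
(* Openness to the right: half of [d] keeps [t] within reach of [m] and strictly beyond it, against
   the choice of [m]. *)
pose t := Num.min b (m + d / 2).
have mt : m < t by rewrite lt_min mltb ltrDl divr_gt0.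
have tb : t <= b by rewrite ge_min lexx.
have tmd : t <= m + d / 2 by rewrite ge_min lexx orbT.
suff /(ub_le_sup supE.2) : E t by rewrite leNgt mt.
case: Em => _ [l cl fl].
split; first by rewrite tb (le_trans am (ltW mt)).
exists (l + edist (c m) (c t)); first exact: chain_rcons (ltW mt).
apply: le_trans (edist_triangle _ (f (c m)) _) _.
have t01 : 0 <= t <= 1.
  by rewrite (le_trans tb b1) (le_trans (le_trans a0 am) (ltW mt)).
have mtd : `|m - t| < d by rewrite distrC ger0_norm ?subr_ge0 ?(ltW mt) //; lra.
by rewrite (edistC _ (f (c t))) (Hm _ mtd t01) (edistC (c t)) lerD2r.
Qed.

(** By [chain_dominates], each link of a polygon inscribed in [f \o c] is at most as long as some
    polygon inscribed in [c] over the same parameters; these are concatenated. *)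
Lemma curve_length_le S f c : locally_isometric S f ->
  {within `[0, 1], continuous c} -> (forall t : R, 0 <= t <= 1 -> S (c t)) ->
  (curve_length (f \o c) <= curve_length c)%E.
Proof.
move=> Sf cc cS; rewrite !curve_lengthE.
have H a b l : 0 <= a -> b <= 1 -> chain (f \o c) a b l ->
    exists2 l', chain c a b l' & l <= l'.
  move=> a0 + fc; elim: fc => [_|x y m fc IH xy y1].
    by exists 0 => //; exact: chain_nil.
  have [l1 c1 l1m] := IH (le_trans xy y1).
  have [l2 c2 l2m] := chain_dominates Sf cc cS (le_trans a0 (chain_le fc)) xy y1.
  by exists (l1 + l2); [exact: chain_cat c2|exact: lerD].
apply: ge_ereal_sup => _ [l /H-/(_ (lexx _) (lexx _))[l' cl' ll'] <-].
apply: le_trans (_ : (l'%:E <= _)%E); first by rewrite lee_fin.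
by apply: ereal_sup_ubound; exists l'.
Qed.

Lemma intrinsic_dist_le S T f x y : locally_isometric S f ->
  (forall p, S p -> T (f p)) ->
  (intrinsic_dist T (f x) (f y) <= intrinsic_dist S x y)%E.
Proof.
move=> Sf ST; apply: le_ereal_inf_tmp => _ [c [cc [cS [c0 c1]]] <-].
apply: le_trans (curve_length_le Sf cc cS); apply: ereal_inf_lbound.
exists (f \o c) => //; split; first exact: locally_isometric_comp Sf cc cS.
by split; [move=> t /cS/ST|rewrite /= c0 c1].
Qed.

(** Each of the two inverse maps does not increase intrinsic distances, hence both preserve them. *)
Lemma locally_isometric_isometry S T f g :
  locally_isometric S f -> locally_isometric T g ->
  (forall p, S p -> T (f p)) -> (forall p, T p -> S (g p)) ->
  (forall p, S p -> g (f p) = p) -> (forall p, T p -> f (g p) = p) ->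
  intrinsically_isometric S T.
Proof.
move=> Sf Tg ST TS gf fg; exists f; split.
  split=> [p /ST//|p q /set_mem Sp /set_mem Sq fpq|p Tp].
    by rewrite -(gf p) // fpq gf.
  by exists (g p); [exact: TS|exact: fg].
move=> x y Sx Sy; apply/eqP; rewrite eq_le (intrinsic_dist_le _ _ Sf ST) /=.
by rewrite -[in leLHS](gf x) // -[in leLHS](gf y) // (intrinsic_dist_le _ _ Tg TS).
Qed.

Lemma intrinsically_isometric_trans S T U : intrinsically_isometric S T ->
  intrinsically_isometric T U -> intrinsically_isometric S U.
Proof.
move=> [f [bf df]] [g [bg dg]]; exists (g \o f); split.
  exact: set_bij_comp bf bg.
have fT x : S x -> T (f x) by move=> Sx; apply: (set_bij_sub bf); exists x.
by move=> x y Sx Sy; rewrite /= dg ?df //; exact: fT.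
Qed.

End LocalIsometry.

(** * The symmetry group of the cube *)

Section Octahedral.
Context {R : realType}.
Implicit Types (p q : pt R).

Definition negx p : pt R := ((- px p, py p), pz p).
Definition swapxy p : pt R := ((py p, px p), pz p).
Definition swapyz p : pt R := ((px p, pz p), py p).

(** These three reflections generate the octahedral group of order 48, so invariance is checked on
    them only. *)
Variant reflection : (pt R -> pt R) -> Prop :=
| Reflection_negx : reflection negx
| Reflection_swapxy : reflection swapxy
| Reflection_swapyz : reflection swapyz.

Lemma reflectionK g : reflection g -> involutive g.
Proof. by case=> -[[x y] z] //; rewrite /negx /= opprK. Qed.

Lemma reflection_padd g p q : reflection g -> g (padd p q) = padd (g p) (g q).
Proof. by case=> //; rewrite /negx /padd /px /= opprD. Qed.

Lemma reflection_pscale g a p : reflection g -> g (pscale a p) = pscale a (g p).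
Proof. by case=> //; rewrite /negx /pscale /px /= mulrN. Qed.

Lemma reflection_det3 g u v w : reflection g ->
  det3 (g u) (g v) (g w) = - det3 u v w.
Proof. by case; rewrite /det3 /px /py /pz /=; ring. Qed.

Lemma reflection_edist g p q : reflection g -> edist (g p) (g q) = edist p q.
Proof. by case; congr Num.sqrt; rewrite /px /py /pz /=; ring. Qed.

(** Sign changes and transpositions bring the second point into the chamber x >= y >= z >= 0; the
    first point undergoes the same symmetry and may land anywhere. *)
Lemma chamber_ind2 (Q : pt R -> pt R -> Prop) :
  (forall g p q, reflection g -> Q (g p) (g q) -> Q p q) ->
  (forall p (x y z : R), 0 <= z -> z <= y -> y <= x -> Q p ((x, y), z)) ->
  forall p q, Q p q.
Proof.
move=> Qg Q0.
have QX := fun p q => @Qg swapxy p q Reflection_swapxy.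
have QY := fun p q => @Qg swapyz p q Reflection_swapyz.
have QN := fun p q => @Qg negx p q Reflection_negx.
have Q1 p x y z : 0 <= y -> 0 <= z -> y <= x -> z <= x -> Q p ((x, y), z).
  move=> y0 z0 yx zx; have [zy|/ltW yz] := leP z y; first exact: Q0.
  by apply: QY; exact: Q0.
have Q2 p x y z : 0 <= x -> 0 <= y -> 0 <= z -> Q p ((x, y), z).
  move=> x0 y0 z0.
  have [zx|/ltW xz] := leP z x; have [yx|/ltW xy] := leP y x.
  - exact: Q1.
  - by apply: QX; apply: Q1 => //; exact: le_trans xy.
  - by apply/QY/QX; apply: Q1 => //; exact: le_trans xz.
  - have [zy|/ltW yz] := leP z y; first by apply: QX; exact: Q1.
    by apply/QY/QX; exact: Q1.
have Q3 p x y z : 0 <= y -> 0 <= z -> Q p ((x, y), z).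
  move=> y0 z0; have [x0|/ltW x0] := leP 0 x; first exact: Q2.
  by apply: QN; apply: Q2 => //; rewrite /px /= oppr_ge0.
have Q4 p x y z : 0 <= z -> Q p ((x, y), z).
  move=> z0; have [y0|/ltW y0] := leP 0 y; first exact: Q3.
  (* Conjugating [negx] by swaps gives the sign change of y, and below that of z. *)
  by apply/QX/QN/QX; apply: Q3 => //; rewrite /px /py /= oppr_ge0.
move=> p [[x y] z]; have [z0|/ltW z0] := leP 0 z; first exact: Q4.
by apply/QY/QX/QN/QX/QY; apply: Q4; rewrite /px /py /pz /= oppr_ge0.
Qed.

Lemma chamber_ind (Q : pt R -> Prop) :
  (forall g p, reflection g -> Q (g p) -> Q p) ->
  (forall x y z : R, 0 <= z -> z <= y -> y <= x -> Q ((x, y), z)) ->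
  forall p, Q p.
Proof.
by move=> Qg Q0 p; apply: (@chamber_ind2 (fun _ => Q) _ _ p p) => [g _|_]; [exact: Qg|exact: Q0].
Qed.

End Octahedral.

(** * The wall arrangement and the reduction to one chamber *)

Section Walls.
Context {R : realType}.
Implicit Types (p q : pt R) (a : R).

(* Indices beyond the list give 0, so the walls include the coordinate planes. *)
Definition wall a (i : nat) p : R :=
  nth 0 [:: a; - a; px p; py p; pz p; - px p; - py p; - pz p] i.

(** Index 8 already stands for all indices beyond the list, so finitely many comparisons suffice in
    [near_specializes]. *)
Lemma wall_minn a i p : wall a (minn i 8) p = wall a i p.
Proof.
have [//|i8] := leqP i 8.
by rewrite /wall [RHS]nth_default //= ltnW.
Qed.

Lemma continuous_wall a i : continuous (wall a i).
Proof.
move=> p; rewrite /wall.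
do 8?[case: i => [|i] /=]; last by rewrite nth_nil; exact: cvg_cst.
- exact: cvg_cst.
- exact: cvg_cst.
- exact: continuous_px.
- exact: continuous_py.
- exact: continuous_pz.
- by apply: cvgN; exact: continuous_px.
- by apply: cvgN; exact: continuous_py.
- by apply: cvgN; exact: continuous_pz.
Qed.

(* p lies in every closed cell of the wall arrangement that contains q. *)
Definition specializes a p q :=
  forall i j, wall a i q <= wall a j q -> wall a i p <= wall a j p.

(** A strict inequality between walls at [p] persists nearby, so a weak inequality at a nearby [q]
    cannot fail at [p]. *)
Lemma near_specializes a p : \forall q \near p, specializes a p q.
Proof.
have H (ij : 'I_9 * 'I_9) : \forall q \near p,
    wall a ij.1 q <= wall a ij.2 q -> wall a ij.1 p <= wall a ij.2 p.
  case: ij => i j /=; have [le_ij|lt_ji] := leP (wall a i p) (wall a j p).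
    by near=> q.
  have c : wall a i q - wall a j q @[q --> p] --> wall a i p - wall a j p.
    by apply: cvgB; exact: continuous_wall.
  rewrite -subr_gt0 in lt_ji.
  near=> q.
  suff : 0 < wall a i q - wall a j q by rewrite subr_gt0 ltNge => /negbTE ->.
  by near: q; exact: (cvgr_gt _ c).
have {}H : \forall q \near p, forall ij : 'I_9 * 'I_9,
    wall a ij.1 q <= wall a ij.2 q -> wall a ij.1 p <= wall a ij.2 p.
  have := @filter_forall _ ('I_9 * 'I_9)%type (fun ij q => wall a ij.1 q <= wall a ij.2 q ->
    wall a ij.1 p <= wall a ij.2 p) (nbhs p) _ H.
  exact.
apply: filterS H => q H i j.
rewrite -(wall_minn _ i) -(wall_minn _ j) -(wall_minn _ i p) -(wall_minn _ j p).
have lt9 k : (minn k 8 < 9)%N by rewrite ltnS geq_minr.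
exact: (H (Ordinal (lt9 i), Ordinal (lt9 j))).
Unshelve. all: by end_near. Qed.

(** The list holds both signs of each coordinate, so reflections permute it. *)
Lemma reflection_wall a g i : reflection g ->
  exists j, forall p, wall a i (g p) = wall a j p.
Proof.
rewrite /wall.
case; (do 8?[case: i => [|i] /=]);
  do ?[by exists 0%N | by exists 1%N | by exists 2%N | by exists 3%N
    | by exists 4%N | by exists 5%N | by exists 6%N | by exists 7%N
    | by exists 8%N => p; rewrite ?nth_nil
    | by exists 2%N => p; rewrite /= /px /= opprK].
Qed.

Lemma reflection_specializes a g p q : reflection g ->
  specializes a p q -> specializes a (g p) (g q).
Proof.
move=> rg H i j; have [i' Hi] := reflection_wall a i rg.
have [j' Hj] := reflection_wall a j rg; rewrite !Hi !Hj; exact: H.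
Qed.

(** A symmetry moves the nearby point [q] into the chamber. The chamber is a closed cell of the
    arrangement, so [p], which specializes [q], is carried into it too. *)
Lemma locally_isometric_chamber a (S : set (pt R)) (f : pt R -> pt R) :
  (forall g p, reflection g -> S p -> S (g p)) ->
  (forall g p, reflection g -> f (g p) = g (f p)) ->
  (forall x y z x' y' z' : R, 0 <= z -> z <= y -> y <= x -> 0 <= z' -> z' <= y' -> y' <= x' ->
    S ((x, y), z) -> S ((x', y'), z') ->
    specializes a ((x', y'), z') ((x, y), z) ->
    edist (f ((x, y), z)) (f ((x', y'), z')) = edist ((x, y), z) ((x', y'), z')) ->
  locally_isometric S f.
Proof.
move=> Sg fg H.
have K p q : specializes a p q -> S q -> S p -> edist (f q) (f p) = edist q p.
  apply: (@chamber_ind2 R (fun p q => specializes a p q -> S q -> S p ->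
      edist (f q) (f p) = edist q p)) => {p q}
    [g p q rg Q c Sq Sp|[[x' y'] z'] x y z z0 zy yx c Sq Sp].
    have := Q (reflection_specializes rg c) (Sg _ _ rg Sq) (Sg _ _ rg Sp).
    by rewrite !(fg _ _ rg) !(reflection_edist _ _ rg).
  (* Index 8 is the zero wall, and 4, 3, 2 are z, y, x. *)
  apply: H => //.
  - exact: (c 8%N 4%N z0).
  - exact: (c 4%N 3%N zy).
  - exact: (c 3%N 2%N yx).
by move=> p Sp; have := near_specializes a p; apply: filterS => q c Sq; exact: K.
Qed.

End Walls.

(** * The inflation map, its inverse, and the isometry of the surfaces *)

Section Inflation.
Context {R : realType}.
Implicit Types (p q : pt R) (x y z u v w : R).

(** Half the side of the central squares, 1/2 - 1/10, for a cube centred at the origin. *)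
Local Notation A := (2 / 5 : R).
Local Notation s := (Num.sqrt 2 : R).

Lemma sqr_sqrt2 : s * s = 2.
Proof. by rewrite -expr2 sqr_sqrtr. Qed.

Lemma sqrt2_gt : 7 / 5 < s.
Proof.
have s0 : 0 <= s := sqrtr_ge0 _; have := sqr_sqrt2.
rewrite ltNge; case: leP => // s75; nra.
Qed.

Lemma sqrt2_lt : s < 3 / 2.
Proof.
have s0 : 0 <= s := sqrtr_ge0 _; have := sqr_sqrt2.
rewrite ltNge; case: leP => // s75; nra.
Qed.

(** The distance from [x] to the interval [-A, A]. For x >= 0 the maps below keep [Num.min x A] and
    act on the excess. *)
Definition excess x := Num.max (`|x| - A) 0.

Lemma excess_ge0 x : 0 <= excess x.
Proof. by rewrite le_max lexx orbT. Qed.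

Lemma excessN x : excess (- x) = excess x.
Proof. by rewrite /excess normrN. Qed.

Lemma excess_small x : 0 <= x -> x <= A -> excess x = 0.
Proof. by move=> x0 xA; apply/max_idPr; rewrite ger0_norm // subr_le0. Qed.

Lemma excess_large x : A <= x -> excess x = x - A.
Proof.
move=> xA; rewrite /excess ger0_norm; last lra.
by apply/max_idPl; rewrite subr_ge0.
Qed.

Lemma le_excess x y : 0 <= y -> y <= x -> excess y <= excess x.
Proof.
move=> y0 yx; rewrite /excess ger0_norm // ger0_norm ?(le_trans y0) //.
by rewrite le_max2 // lerB.
Qed.

Lemma split_excess x : 0 <= x ->
  [/\ x = Num.min x A + excess x, 0 <= Num.min x A, Num.min x A <= A &
      Num.min x A = A \/ excess x = 0].
Proof.
move=> x0; have [xA|Ax] := leP x A.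
  by rewrite excess_small // addr0; split=> //; right.
rewrite excess_large ?(ltW Ax) //; split; [lra|lra|by []|by left].
Qed.

(** The alternative [m = A \/ u = 0] makes the decomposition of [split_excess] unique, so the two
    parts of an image coordinate can be read off. *)
Lemma excess_split m u : 0 <= m -> m <= A -> 0 <= u -> m = A \/ u = 0 ->
  Num.min (m + u) A = m /\ excess (m + u) = u.
Proof.
move=> m0 mA u0 [->|->].
  rewrite excess_large ?lerDl //; split; last lra.
  by apply/min_idPr; rewrite lerDl.
by rewrite addr0 excess_small //; split=> //; apply/min_idPl.
Qed.

(* On the excesses xi >= eta >= zeta of a point of the chamber
   x >= y >= z >= 0, inflation is s times the linear map
   (xi - eta/2 + zeta/6, eta/2 + zeta/6, 2 zeta/3), which is isometric on the
   planes where xi is constant. *)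
Definition inflate1 x y z :=
  Num.sg x * (Num.min `|x| A + s * (excess x / 2 +
    Num.min (excess x) (Num.min (excess y) (excess z)) / 6 +
    Num.max (excess x - Num.max (excess y) (excess z)) 0 / 2)).

Definition inflate p : pt R :=
  ((inflate1 (px p) (py p) (pz p), inflate1 (py p) (px p) (pz p)),
   inflate1 (pz p) (px p) (py p)).

(** On the excesses xi >= eta >= zeta of a chamber point this is s/2 times the linear map (xi + eta
    - zeta/2, 2 eta - zeta/2, 3 zeta/2), inverse to that of inflation because s * s = 2. *)
Definition deflate1 x y z :=
  Num.sg x * (Num.min `|x| A + s / 2 * (2 * excess x -
    Num.min (excess x) (Num.min (excess y) (excess z)) / 2 -
    Num.max (excess x - Num.max (excess y) (excess z)) 0)).

Definition deflate p : pt R :=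
  ((deflate1 (px p) (py p) (pz p), deflate1 (py p) (px p) (pz p)),
   deflate1 (pz p) (px p) (py p)).

Lemma inflate1C x y z : inflate1 x y z = inflate1 x z y.
Proof. by rewrite /inflate1 (minC (excess y)) (maxC (excess y)). Qed.

Lemma deflate1C x y z : deflate1 x y z = deflate1 x z y.
Proof. by rewrite /deflate1 (minC (excess y)) (maxC (excess y)). Qed.

(** The min and max are symmetric in the other two excesses and the sign is a separate factor, so no
    case analysis on the order of coordinates arises. *)
Lemma inflate_reflection g p : reflection g -> inflate (g p) = g (inflate p).
Proof.
case; rewrite /inflate /negx /swapxy /swapyz /px /py /pz /=.
- by rewrite /inflate1 sgrN normrN mulNr !excessN.
- by rewrite (inflate1C p.2).
- by rewrite (inflate1C p.1.1) .
Qed.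

Lemma deflate_reflection g p : reflection g -> deflate (g p) = g (deflate p).
Proof.
case; rewrite /deflate /negx /swapxy /swapyz /px /py /pz /=.
- by rewrite /deflate1 sgrN normrN mulNr !excessN.
- by rewrite (deflate1C p.2).
- by rewrite (deflate1C p.1.1).
Qed.

Lemma sgr_mull x u : 0 <= x -> (x = 0 -> u = 0) -> Num.sg x * u = u.
Proof.
rewrite le_eqVlt => /predU1P[<- /(_ erefl)->|x0 _]; first by rewrite mulr0.
by rewrite gtr0_sg // mul1r.
Qed.

Lemma inflate1_ge0 x y z : 0 <= x -> inflate1 x y z =
  Num.min x A + s * (excess x / 2 +
    Num.min (excess x) (Num.min (excess y) (excess z)) / 6 +
    Num.max (excess x - Num.max (excess y) (excess z)) 0 / 2).
Proof.
move=> x0; rewrite /inflate1 (ger0_norm x0) sgr_mull // => ->.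
rewrite excess_small //; try lra.
have /min_idPl -> : 0 <= Num.min (excess y) (excess z) by rewrite le_min !excess_ge0.
have /max_idPr -> : 0 - Num.max (excess y) (excess z) <= 0.
  by rewrite sub0r oppr_le0 le_max excess_ge0.
have /min_idPl -> : 0 <= A by lra.
by rewrite !mul0r !addr0 mulr0 addr0.
Qed.

Lemma deflate1_ge0 x y z : 0 <= x -> deflate1 x y z =
  Num.min x A + s / 2 * (2 * excess x -
    Num.min (excess x) (Num.min (excess y) (excess z)) / 2 -
    Num.max (excess x - Num.max (excess y) (excess z)) 0).
Proof.
move=> x0; rewrite /deflate1 (ger0_norm x0) sgr_mull // => ->.
rewrite excess_small //; try lra.
have /min_idPl -> : 0 <= Num.min (excess y) (excess z) by rewrite le_min !excess_ge0.
have /max_idPr -> : 0 - Num.max (excess y) (excess z) <= 0.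
  by rewrite sub0r oppr_le0 le_max excess_ge0.
have /min_idPl -> : 0 <= A by lra.
by rewrite mulr0 !mul0r !subr0 mulr0 addr0.
Qed.

Section Chamber.
Variables x y z : R.
Hypotheses (z0 : 0 <= z) (zy : z <= y) (yx : y <= x).

Let y0 : 0 <= y. Proof. exact: le_trans zy. Qed.
Let x0 : 0 <= x. Proof. exact: le_trans yx. Qed.
Let ezy : excess z <= excess y. Proof. exact: le_excess. Qed.
Let eyx : excess y <= excess x. Proof. exact: le_excess. Qed.
Let ezx : excess z <= excess x. Proof. exact: le_trans eyx. Qed.

Lemma inflate_chamber : inflate ((x, y), z) =
  ((Num.min x A + s * (excess x - excess y / 2 + excess z / 6),
    Num.min y A + s * (excess y / 2 + excess z / 6)),
   Num.min z A + s * (2 * excess z / 3)).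
Proof.
rewrite /inflate !inflate1_ge0 //= /px /py /pz /=.
rewrite (max_idPl ezy) (max_idPl ezx) (max_idPl eyx) (min_idPr ezy) (min_idPr ezx).
rewrite (min_idPr eyx) (min_idPl ezy) (min_idPr ezy).
have /max_idPl -> : 0 <= excess x - excess y by rewrite subr_ge0.
have /max_idPr -> : excess y - excess x <= 0 by rewrite subr_le0.
have /max_idPr -> : excess z - excess x <= 0 by rewrite subr_le0.
congr (_ + _, _ + _, _ + _); congr (s * _); lra.
Qed.

Lemma deflate_chamber : deflate ((x, y), z) =
  ((Num.min x A + s / 2 * (excess x + excess y - excess z / 2),
    Num.min y A + s / 2 * (2 * excess y - excess z / 2)),
   Num.min z A + s / 2 * (3 * excess z / 2)).
Proof.
rewrite /deflate !deflate1_ge0 //= /px /py /pz /=.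
rewrite (max_idPl ezy) (max_idPl ezx) (max_idPl eyx) (min_idPr ezy) (min_idPr ezx).
rewrite (min_idPr eyx) (min_idPl ezy) (min_idPr ezy).
have /max_idPl -> : 0 <= excess x - excess y by rewrite subr_ge0.
have /max_idPr -> : excess y - excess x <= 0 by rewrite subr_le0.
have /max_idPr -> : excess z - excess x <= 0 by rewrite subr_le0.
by congr (_ + _, _ + _, _ + _); congr (_ * _); lra.
Qed.

End Chamber.

Definition maxnorm p := Num.max (Num.max `|px p| `|py p|) `|pz p|.

(* Its sublevel set at 2 h is the inflated cube, h being sqrt 2 / 10. *)
Definition gauge p :=
  2 * (excess (px p) + excess (py p) + excess (pz p)) -
  3 * Num.min (Num.min (excess (px p)) (excess (py p))) (excess (pz p)).

Lemma maxnorm_reflection g p : reflection g -> maxnorm (g p) = maxnorm p.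
Proof.
case; rewrite /maxnorm /negx /swapxy /swapyz /px /py /pz /= ?normrN //.
  by rewrite (maxC `|p.1.2|).
by rewrite maxAC.
Qed.

Lemma gauge_reflection g p : reflection g -> gauge (g p) = gauge p.
Proof.
case; rewrite /gauge /negx /swapxy /swapyz /px /py /pz /= ?excessN //.
  by rewrite (minC (excess p.1.2)) (addrC (excess p.1.2)).
by rewrite minAC addrAC.
Qed.

Lemma maxnorm_chamber x y z : 0 <= z -> z <= y -> y <= x ->
  maxnorm ((x, y), z) = x.
Proof.
move=> z0 zy yx; rewrite /maxnorm /px /py /pz /= !ger0_norm //; try lra.
by rewrite (max_idPl yx) (max_idPl (le_trans zy yx)).
Qed.

Lemma gauge_chamber x y z : 0 <= z -> z <= y -> y <= x ->
  gauge ((x, y), z) = 2 * excess x + 2 * excess y - excess z.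
Proof.
move=> z0 zy yx; rewrite /gauge /px /py /pz /=.
have y0 := le_trans z0 zy.
rewrite (min_idPr (le_excess y0 yx)) (min_idPr (le_excess z0 zy)); lra.
Qed.


(** Common to both maps: when the excesses are replaced by ordered values that vanish where the old
    ones do, the image stays in the chamber with exactly these excesses. *)
Lemma chamber_shift x y z u v w :
  0 <= z -> z <= y -> y <= x -> 0 <= w -> w <= v -> v <= u ->
  (excess x = 0 -> u = 0) -> (excess y = 0 -> v = 0) -> (excess z = 0 -> w = 0) ->
  let x' := Num.min x A + u in let y' := Num.min y A + v in
  let z' := Num.min z A + w in
  [/\ 0 <= z', z' <= y' & y' <= x'] /\
  ((Num.min x' A = Num.min x A /\ excess x' = u) /\
   (Num.min y' A = Num.min y A /\ excess y' = v) /\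
   (Num.min z' A = Num.min z A /\ excess z' = w)).
Proof.
move=> z0 zy yx w0 wv vu xu yv zw x' y' z'.
have y0 := le_trans z0 zy; have x0 := le_trans y0 yx.
have minyx : Num.min y A <= Num.min x A by rewrite le_min2.
have minzy : Num.min z A <= Num.min y A by rewrite le_min2.
have H t r : 0 <= t -> 0 <= r -> (excess t = 0 -> r = 0) ->
    Num.min (Num.min t A + r) A = Num.min t A /\ excess (Num.min t A + r) = r.
  move=> t0 r0 tr; have [_ mt0 mtA mt] := split_excess t0.
  by apply: excess_split => //; case: mt; [left|right; exact: tr].
have [_ mz0 _ _] := split_excess z0.
split; last by split; [|split]; apply: H => //; lra.
by rewrite /x' /y' /z'; split; lra.
Qed.

Lemma inflate_chamber_excess x y z : 0 <= z -> z <= y -> y <= x ->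
  exists x' y' z', inflate ((x, y), z) = ((x', y'), z') /\
  [/\ 0 <= z', z' <= y' & y' <= x'] /\
  ((Num.min x' A = Num.min x A /\
     excess x' = s * (excess x - excess y / 2 + excess z / 6)) /\
   (Num.min y' A = Num.min y A /\ excess y' = s * (excess y / 2 + excess z / 6)) /\
   (Num.min z' A = Num.min z A /\ excess z' = s * (2 * excess z / 3))).
Proof.
move=> z0 zy yx.
have y0 := le_trans z0 zy; have eyx := le_excess y0 yx.
have ezy := le_excess z0 zy; have ez := excess_ge0 z.
have s0 : 0 < s by rewrite sqrtr_gt0.
rewrite inflate_chamber //; do 3 eexists; split; first by [].
apply: chamber_shift => //; rewrite ?ler_pM2l //; try lra.
- by rewrite mulr_ge0 ?(ltW s0) //; lra.
- by move=> e; apply/eqP; rewrite mulrI_eq0 ?lt0r_neq0 //; [apply/eqP; lra|exact/lregP/lt0r_neq0].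
- by move=> e; apply/eqP; rewrite mulrI_eq0 ?lt0r_neq0 //; [apply/eqP; lra|exact/lregP/lt0r_neq0].
- by move=> e; apply/eqP; rewrite mulrI_eq0 ?lt0r_neq0 //; [apply/eqP; lra|exact/lregP/lt0r_neq0].
Qed.

Lemma deflate_chamber_excess x y z : 0 <= z -> z <= y -> y <= x ->
  exists x' y' z', deflate ((x, y), z) = ((x', y'), z') /\
  [/\ 0 <= z', z' <= y' & y' <= x'] /\
  ((Num.min x' A = Num.min x A /\
     excess x' = s / 2 * (excess x + excess y - excess z / 2)) /\
   (Num.min y' A = Num.min y A /\ excess y' = s / 2 * (2 * excess y - excess z / 2)) /\
   (Num.min z' A = Num.min z A /\ excess z' = s / 2 * (3 * excess z / 2))).
Proof.
move=> z0 zy yx.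
have y0 := le_trans z0 zy; have eyx := le_excess y0 yx.
have ezy := le_excess z0 zy; have ez := excess_ge0 z.
have s0 : 0 < s / 2 by rewrite divr_gt0 ?sqrtr_gt0.
rewrite deflate_chamber //; do 3 eexists; split; first by [].
apply: chamber_shift => //; rewrite ?ler_pM2l //; try lra.
- by rewrite mulr_ge0 ?(ltW s0) //; lra.
- by move=> e; rewrite (_ : _ - _ = 0) ?mulr0 //; lra.
- by move=> e; rewrite (_ : _ - _ = 0) ?mulr0 //; lra.
- by move=> e; rewrite e mulr0 mul0r mulr0.
Qed.

Lemma half_sqrt2K u v : v = s * u -> s / 2 * v = u.
Proof.
move=> ->; have -> : s / 2 * (s * u) = s * s * u / 2 by field.
by rewrite sqr_sqrt2; lra.
Qed.

Lemma sqrt2_halfK u v : v = s / 2 * u -> s * v = u.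
Proof.
move=> ->; have -> : s * (s / 2 * u) = s * s * u / 2 by field.
by rewrite sqr_sqrt2; lra.
Qed.

Lemma inflateK : cancel inflate deflate.
Proof.
apply: chamber_ind => [g p rg|x y z z0 zy yx].
  rewrite (inflate_reflection _ rg) (deflate_reflection _ rg).
  by move/(inv_inj (reflectionK rg)).
have [x' [y' [z' [-> [[z0' zy' yx'] [[mx ex] [[my ey] [mz ez]]]]]]]] :=
  inflate_chamber_excess z0 zy yx.
have y0 := le_trans z0 zy; have x0 := le_trans y0 yx.
have [dx _ _ _] := split_excess x0; have [dy _ _ _] := split_excess y0.
have [dz _ _ _] := split_excess z0.
rewrite deflate_chamber // mx my mz ex ey ez [in RHS]dx [in RHS]dy [in RHS]dz.
by congr (_ + _, _ + _, _ + _); apply: half_sqrt2K; field.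
Qed.

Lemma deflateK : cancel deflate inflate.
Proof.
apply: chamber_ind => [g p rg|x y z z0 zy yx].
  rewrite (deflate_reflection _ rg) (inflate_reflection _ rg).
  by move/(inv_inj (reflectionK rg)).
have [x' [y' [z' [-> [[z0' zy' yx'] [[mx ex] [[my ey] [mz ez]]]]]]]] :=
  deflate_chamber_excess z0 zy yx.
have y0 := le_trans z0 zy; have x0 := le_trans y0 yx.
have [dx _ _ _] := split_excess x0; have [dy _ _ _] := split_excess y0.
have [dz _ _ _] := split_excess z0.
rewrite inflate_chamber // mx my mz ex ey ez [in RHS]dx [in RHS]dy [in RHS]dz.
by congr (_ + _, _ + _, _ + _); apply: sqrt2_halfK; field.
Qed.

(** In the chamber the terms in eta and zeta cancel in 2 X + 2 Y - Z, where X, Y, Z are the excesses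
    of the image; 2 s xi remains. *)
Lemma gauge_inflate p : gauge (inflate p) = 2 * s * excess (maxnorm p).
Proof.
move: p; apply: chamber_ind => [g p rg|x y z z0 zy yx].
  by rewrite (inflate_reflection _ rg) (gauge_reflection _ rg) (maxnorm_reflection _ rg).
have [x' [y' [z' [-> [[z0' zy' yx'] [[mx ex] [[my ey] [mz ez]]]]]]]] :=
  inflate_chamber_excess z0 zy yx.
by rewrite gauge_chamber // maxnorm_chamber // ex ey ez; field.
Qed.

Definition cube_surface : set (pt R) := [set p | maxnorm p = 1 / 2].

(** The level s / 5 is 2 s times 1/10, the excess of 1/2. *)
Definition inflated_surface : set (pt R) := [set p | gauge p = s / 5].

Lemma maxnorm_ge0 p : 0 <= maxnorm p.
Proof. by rewrite !le_max normr_ge0. Qed.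

Lemma inflate_surface p : inflated_surface (inflate p) <-> cube_surface p.
Proof.
rewrite /inflated_surface /cube_surface /= gauge_inflate.
have s0 : 0 < s by rewrite sqrtr_gt0.
split=> [H|->]; last by rewrite excess_large; [field|lra].
have e : excess (maxnorm p) = 1 / 10.
  by apply: (mulfI (lt0r_neq0 s0)); apply: (mulfI (_ : 2 != 0)) => //; rewrite mulrA H; field.
have [pA|Ap] := leP (maxnorm p) A.
  by move: e; rewrite excess_small ?maxnorm_ge0 //; lra.
by move: e; rewrite excess_large ?(ltW Ap) //; lra.
Qed.

(** On the face x = 1/2 the chamber has three pieces: central square (y <= A), strip (z <= A <= y)
    and corner (A <= z). Both points lie in a common piece, where the map is affine and
    isometric. *)
Lemma locally_isometric_inflate : locally_isometric cube_surface inflate.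
Proof.
apply: (@locally_isometric_chamber R A).
- by move=> g p rg; rewrite /cube_surface /= maxnorm_reflection.
- by move=> g p rg; exact: inflate_reflection.
move=> x y z x' y' z' z0 zy yx z0' zy' yx'.
rewrite /cube_surface /= !maxnorm_chamber // => ex ex' c.
rewrite !inflate_chamber //; subst x x'.
have s2 := sqr_sqrt2.
have y0 := le_trans z0 zy; have y0' := le_trans z0' zy'.
have [yA|Ay] := leP y A.
  have yA' : y' <= A by exact: (c 3%N 0%N yA).
  rewrite (min_idPl yA') (min_idPl (le_trans zy yA)).
  rewrite (min_idPl (le_trans zy' yA')) !(excess_small _ yA) // !(excess_small _ yA') //.
  rewrite !(excess_small _ (le_trans zy yA)) // !(excess_small _ (le_trans zy' yA')) //.
  by congr Num.sqrt; rewrite /px /py /pz /=; field.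
have Ay' : A <= y' by exact: (c 0%N 3%N (ltW Ay)).
rewrite (min_idPr Ay') (excess_large (ltW Ay)) (excess_large Ay').
have [zA|Az] := leP z A.
  have zA' : z' <= A by exact: (c 4%N 0%N zA).
  rewrite (min_idPl zA') !(excess_small _ zA) // !(excess_small _ zA') //.
  congr Num.sqrt; rewrite /px /py /pz /=.
  (* The difference from the wanted value is isolated as a multiple of s * s - 2. *)
  transitivity (0 + (y - y') ^+ 2 + (z - z') ^+ 2 + (s * s - 2) * ((y - y') ^+ 2 / 2)).
    by field.
  by rewrite s2 subrr; ring.
have Az' : A <= z' by exact: (c 0%N 4%N (ltW Az)).
rewrite (min_idPr Az') (excess_large (ltW Az)) (excess_large Az').
congr Num.sqrt; rewrite /px /py /pz /=.
transitivity (0 + (y - y') ^+ 2 + (z - z') ^+ 2 +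
    (s * s - 2) * (((y - y') ^+ 2 + (z - z') ^+ 2) / 2)).
  by field.
by rewrite s2 subrr; ring.
Qed.

Lemma locally_isometric_deflate : locally_isometric inflated_surface deflate.
Proof.
apply: (@locally_isometric_chamber R A).
- by move=> g p rg; rewrite /inflated_surface /= gauge_reflection.
- by move=> g p rg; exact: deflate_reflection.
move=> x y z x' y' z' z0 zy yx z0' zy' yx'.
rewrite /inflated_surface /= !gauge_chamber // => e e' c.
rewrite !deflate_chamber //.
have s2 := sqr_sqrt2; have s0 : 0 < s by rewrite sqrtr_gt0.
have y0 := le_trans z0 zy; have y0' := le_trans z0' zy'.
have eyx := le_excess y0 yx; have ezy := le_excess z0 zy.
have eyx' := le_excess y0' yx'; have ezy' := le_excess z0' zy'.
(* Otherwise all excesses vanish, and the gauge would be 0 instead of s / 5. *)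
have Ax : A <= x.
  have [//|xA] := leP A x; move: e eyx ezy.
  rewrite (excess_small (le_trans y0 yx) (ltW xA)); have := excess_ge0 y; have := excess_ge0 z; lra.
have Ax' : A <= x'.
  have [//|xA] := leP A x'; move: e' eyx' ezy'.
  rewrite (excess_small (le_trans y0' yx') (ltW xA)); have := excess_ge0 y'; have := excess_ge0 z'; lra.
(* The surface equation makes the first coordinate of the image constant; in each piece it also
   eliminates x below. *)
have Dx : excess x + excess y - excess z / 2 = s / 10 by lra.
have Dx' : excess x' + excess y' - excess z' / 2 = s / 10 by lra.
rewrite Dx Dx' (min_idPr Ax) (min_idPr Ax') {Dx Dx'}; move: e e'.
rewrite (excess_large Ax) (excess_large Ax').
have [yA|Ay] := leP y A.
  have yA' : y' <= A by exact: (c 3%N 0%N yA).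
  rewrite (min_idPl yA') (min_idPl (le_trans zy yA)).
  rewrite (min_idPl (le_trans zy' yA')) !(excess_small _ yA) // !(excess_small _ yA') //.
  rewrite !(excess_small _ (le_trans zy yA)) // !(excess_small _ (le_trans zy' yA')) //.
  move=> e e'; have -> : x = x' by lra.
  by congr Num.sqrt; rewrite /px /py /pz /=; field.
have Ay' : A <= y' by exact: (c 0%N 3%N (ltW Ay)).
rewrite (min_idPr Ay') (excess_large (ltW Ay)) (excess_large Ay').
have [zA|Az] := leP z A.
  have zA' : z' <= A by exact: (c 4%N 0%N zA).
  rewrite (min_idPl zA') !(excess_small _ zA) // !(excess_small _ zA') // => e e'.
  have -> : x = s / 10 + 2 * A - y by lra.
  have -> : x' = s / 10 + 2 * A - y' by lra.
  congr Num.sqrt; rewrite /px /py /pz /=.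
  transitivity ((y' - y) ^+ 2 + (y - y') ^+ 2 + (z - z') ^+ 2 + (s * s - 2) * (y - y') ^+ 2).
    by field.
  by rewrite s2 subrr; field.
have Az' : A <= z' by exact: (c 0%N 4%N (ltW Az)).
rewrite (min_idPr Az') (excess_large (ltW Az)) (excess_large Az') => e e'.
have -> : x = s / 10 + A + z / 2 + A / 2 - y by lra.
have -> : x' = s / 10 + A + z' / 2 + A / 2 - y' by lra.
congr Num.sqrt; rewrite /px /py /pz /=.
transitivity (((z - z') / 2 - (y - y')) ^+ 2 + (y - y') ^+ 2 + (z - z') ^+ 2 +
    (s * s - 2) * ((y - y') ^+ 2 - (y - y') * (z - z') / 2 + 5 / 8 * (z - z') ^+ 2)).
  by field.
by rewrite s2 subrr; field.
Qed.
End Inflation.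

(** * Boundaries of the two bodies and non-convexity *)

Section Boundary.
Context {R : realType}.
Implicit Types (p q d : pt R) (N : pt R -> R).

Lemma cvg_ray p d : padd p (pscale t d) @[t --> (0 : R)^'+] --> p.
Proof.
apply: cvg_edist => e e0.
pose K := `|px d| + `|py d| + `|pz d| + 1.
have K0 : 0 < K by rewrite ltr_wpDl // !addr_ge0.
near=> t.
have t0 : 0 < t by near: t; exact: nbhs_right_gt.
have te : t < e / K by near: t; apply: nbhs_right_lt; rewrite divr_gt0.
apply: le_lt_trans (edist_le_norm _ _) _.
have E u v : `|u + t * v - u| = t * `|v| by rewrite addrAC subrr add0r normrM gtr0_norm.
rewrite /padd /pscale /px /py /pz /= !E -!mulrDr.
rewrite ltr_pdivlMr // in te; apply: le_lt_trans te.
by rewrite ler_pM2l // /K lerDl.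
Unshelve. all: by end_near. Qed.

(** Continuity makes points with N p < c interior; a ray leaving the sublevel set at once shows that
    a point of the level set is not. *)
Lemma bd_sublevel N (c : R) : continuous N ->
  (forall p, N p = c -> exists d, forall t : R, 0 < t -> c < N (padd p (pscale t d))) ->
  bd [set p | N p <= c] = [set p | N p = c].
Proof.
move=> cN H; rewrite /bd.
have cl : closed [set p | N p <= c].
  by apply: (@closed_comp _ _ N [set x | x <= c]) => [p _|]; [exact: cN|exact: closed_le].
rewrite -(closure_id _).1 //; apply/seteqP; split=> p /=; last first.
  move=> Np; split; first by rewrite Np.
  have [d Hd] := H p Np => /(@cvg_ray p d) near_le.
  have : \forall t \near (0 : R)^'+, False.
    near=> t.
    have t0 : 0 < t by near: t; exact: nbhs_right_gt.
    have : N (padd p (pscale t d)) <= c by near: t.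
    by rewrite leNgt Hd.
  by move/filter_ex => [].
move=> [Npc nint]; apply/eqP; rewrite eq_le Npc /= leNgt; apply/negP => ltNc.
apply: nint; rewrite /interior /=; near=> q; apply/ltW.
by near: q; exact: (cvgr_lt _ (cN p)).
Unshelve. all: by end_near. Qed.

Lemma continuous_maxnorm : continuous (@maxnorm R).
Proof.
move=> p.
have cx : {for p, continuous (fun p => `|px p| : R^o)} by apply: cvg_norm; exact: continuous_px.
have cy : {for p, continuous (fun p => `|py p| : R^o)} by apply: cvg_norm; exact: continuous_py.
have cz : {for p, continuous (fun p => `|pz p| : R^o)} by apply: cvg_norm; exact: continuous_pz.
exact: (continuous_max (continuous_max cx cy) cz).
Qed.

Lemma continuous_excess : continuous (@excess R).
Proof.
move=> x.
have cx : {for x, continuous (fun x : R => `|x| - 2 / 5 : R^o)}.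
  by apply: cvgB; [exact: norm_continuous|exact: cvg_cst].
have c0 : {for x, continuous (fun=> 0 : R^o)} by exact: cvg_cst.
exact: (continuous_max cx c0).
Qed.

Lemma continuous_gauge : continuous (@gauge R).
Proof.
move=> p; rewrite /gauge.
have cx : {for p, continuous (fun p => excess (px p) : R^o)}.
  by apply: continuous_comp; [exact: continuous_px|exact: continuous_excess].
have cy : {for p, continuous (fun p => excess (py p) : R^o)}.
  by apply: continuous_comp; [exact: continuous_py|exact: continuous_excess].
have cz : {for p, continuous (fun p => excess (pz p) : R^o)}.
  by apply: continuous_comp; [exact: continuous_pz|exact: continuous_excess].
apply: cvgB; apply: cvgM; try exact: cvg_cst.
  by apply: cvgD => //; exact: cvgD.
exact: (continuous_min (continuous_min cx cy) cz).
Qed.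

Definition inflated_cube : set (pt R) := [set p | gauge p <= Num.sqrt 2 / 5].

Lemma bd_inflated_cube : bd inflated_cube = inflated_surface.
Proof.
apply: bd_sublevel => [|p]; first exact: continuous_gauge.
move: p; apply: chamber_ind => [g p rg|x y z z0 zy yx] H.
  rewrite gauge_reflection // in H => Np; have [d Hd] := H Np.
  exists (g d) => t t0; rewrite -(reflectionK rg p) -reflection_pscale //.
  by rewrite -reflection_padd // gauge_reflection //; exact: Hd.
have s0 : 0 < Num.sqrt 2 :> R by rewrite sqrtr_gt0.
have y0 := le_trans z0 zy; have eyx := le_excess y0 yx.
have xA : 2 / 5 <= x.
  have [//|xA] := leP (2 / 5) x; move: H eyx (le_excess z0 zy); rewrite gauge_chamber //.
  rewrite (excess_small (le_trans y0 yx) (ltW xA)); have := excess_ge0 y.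
  have := excess_ge0 z; lra.
(* Moving along x stays in the chamber and, as x >= A, raises the gauge at rate 2. *)
exists ((1, 0), 0) => t t0; rewrite /padd /pscale /px /py /pz /= mulr1 mulr0 !addr0.
rewrite -H !gauge_chamber //; try lra.
have xtA : 2 / 5 <= x + t by lra.
rewrite (excess_large xA) (excess_large xtA); lra.
Qed.

(** The construction is symmetric about the origin, so the unit cube is first translated. *)
Definition center : pt R := ((1 / 2, 1 / 2), 1 / 2).

Lemma unit_cubeE : @unit_cube R = [set p | maxnorm (psub p center) <= 1 / 2].
Proof.
apply/seteqP; split=> p /=; rewrite /unit_cube /maxnorm /= !ge_max !ler_norml;
  rewrite /psub /padd /pscale /px /py /pz /=.
- move=> [/andP[? ?] [/andP[? ?] /andP[? ?]]].
  by do ?[apply/andP; split]; lra.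
- move=> /andP[/andP[/andP[? ?] /andP[? ?]] /andP[? ?]].
  by split; [|split]; apply/andP; split; lra.
Qed.

Lemma continuous_translation (d : pt R) : continuous (fun p => padd p d).
Proof.
move=> p; apply: cvg_edist => e e0; near=> q.
have -> : edist (padd q d) (padd p d) = edist q p.
  by congr Num.sqrt; rewrite /padd /px /py /pz /=; ring.
by near: q; exact: near_edist.
Unshelve. all: by end_near. Qed.

Lemma maxnorm_pscale (a : R) p : 0 <= a -> maxnorm (pscale a p) = a * maxnorm p.
Proof.
move=> a0; rewrite /maxnorm /pscale /px /py /pz /= !normrM (ger0_norm a0).
by rewrite !maxr_pMr.
Qed.

Lemma bd_unit_cube :
  bd (@unit_cube R) = [set p | cube_surface (psub p center)].
Proof.
rewrite unit_cubeE; apply: bd_sublevel => [p|p Np].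
  have c : {for p, continuous (fun p => psub p center)} by exact: continuous_translation.
  exact: (continuous_comp c (@continuous_maxnorm _)).
(* The radial direction: [maxnorm] is multiplied by 1 + t. *)
exists (psub p center) => t t0.
have -> : psub (padd p (pscale t (psub p center))) center =
    pscale (1 + t) (psub p center).
  by rewrite /psub /padd /pscale /px /py /pz /=; congr (_, _, _); ring.
rewrite maxnorm_pscale; last lra.
by rewrite Np; lra.
Qed.

Lemma locally_isometric_translation (d : pt R) S :
  locally_isometric S (fun p => padd p d).
Proof.
move=> p _; near=> q => _.
by congr Num.sqrt; rewrite /padd /px /py /pz /=; ring.
Unshelve. all: by end_near. Qed.

Lemma isometric_inflated_cube :
  intrinsically_isometric (bd (@unit_cube R)) (bd inflated_cube).
Proof.
rewrite bd_inflated_cube bd_unit_cube.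
have E p : padd (psub p center) center = p.
  by case: p => [[x y] z]; rewrite /psub /padd /pscale /px /py /pz /=; congr (_, _, _); ring.
have E' p : psub (padd p center) center = p.
  by case: p => [[x y] z]; rewrite /psub /padd /pscale /px /py /pz /=; congr (_, _, _); ring.
apply: (@intrinsically_isometric_trans _ _ (@cube_surface R)).
  apply: (locally_isometric_isometry (@locally_isometric_translation (pscale (-1) center) _)
    (@locally_isometric_translation center _)) => p //=.
  - by rewrite E'.
  - by move=> _; exact: E.
  - by move=> _; exact: E'.
apply: (locally_isometric_isometry (@locally_isometric_inflate R)
  (@locally_isometric_deflate R)) => p.
- by move/inflate_surface.
- by move=> H; apply/inflate_surface; rewrite deflateK.
- by move=> _; exact: inflateK.
- by move=> _; exact: deflateK.
Qed.

Lemma inflated_cube_not_convex : ~ convex3 inflated_cube.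
Proof.
set s := Num.sqrt 2 : R.
have s1 : 7 / 5 < s := sqrt2_gt; have s2 : s < 3 / 2 := sqrt2_lt.
(* (m, m, 0) lies on the midline of a flattened strip and (k, k, k) is the apex of a pyramid. Both
   have gauge s / 5, but their midpoint has gauge 7 s / 30. *)
pose m := 2 / 5 + s / 20; pose k := 2 / 5 + s / 15.
move=> /(_ ((m, m), 0) ((k, k), k) (1 / 2)); rewrite /inflated_cube /= -/s.
have -> : padd (pscale (1 - 1 / 2) ((m, m), 0)) (pscale (1 / 2) ((k, k), k)) =
   (((m + k) / 2, (m + k) / 2), k / 2) :> pt R.
  by rewrite /padd /pscale /px /py /pz /=; congr (_, _, _); field.
rewrite !gauge_chamber ?lexx //; rewrite /m /k; try lra.
rewrite (excess_small (_ : 0 <= 0)) // ?(excess_small (_ : 0 <= (2 / 5 + s / 15) / 2)); try lra.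
rewrite !excess_large; try lra.
Qed.
End Boundary.

(** * Unions and mirror images of polyhedra *)

Section Polyhedra.
Context {R : realType}.
Implicit Types (p q a b c d : pt R) (S T : set (pt R)).

Lemma polyhedron_tetra a b c d : nondegenerate a b c d -> polyhedron (tetra a b c d).
Proof.
move=> nd; exists [:: (a, b, c, d)]; split=> //; split.
  by move=> t; rewrite inE => /eqP ->.
apply/seteqP; split=> [p Tp|p [t /=]]; first by exists (a, b, c, d) => //=; rewrite inE.
by rewrite inE => /eqP ->.
Qed.

Lemma polyhedron_setU S T : polyhedron S -> polyhedron T -> polyhedron (S `|` T).
Proof.
move=> [s [s0 [snd ->]]] [t [t0 [tnd ->]]]; exists (s ++ t); split.
  by case: s s0 {snd}.
split=> [u|]; first by rewrite mem_cat => /orP[/snd|/tnd].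
apply/seteqP; split=> p.
  by move=> [[u /= us pu]|[u /= ut pu]]; exists u => //=; rewrite mem_cat ?us ?ut ?orbT.
by move=> [u /=]; rewrite mem_cat => /orP[us|ut] pu; [left|right]; exists u.
Qed.

Lemma reflection_tetra g a b c d p : reflection g ->
  tetra a b c d (g p) -> tetra (g a) (g b) (g c) (g d) p.
Proof.
move=> rg [la [lb [lc [ld [l0 E]]]]]; exists la, lb, lc, ld; split=> //.
by rewrite -(reflectionK rg p) E !(reflection_padd _ _ rg) !(reflection_pscale _ _ rg).
Qed.

Lemma polyhedron_reflection g S : reflection g -> polyhedron S ->
  polyhedron [set p | S (g p)].
Proof.
move=> rg [s [s0 [snd ->]]].
have gK := reflectionK rg.
pose G (t : pt R * pt R * pt R * pt R) := (g t.1.1.1, g t.1.1.2, g t.1.2, g t.2).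
exists (map G s); split; first by case: s s0 {snd}.
split.
  move=> _ /mapP[t /snd nd ->]; move: nd; rewrite /nondegenerate /G /=.
  rewrite /psub -!(reflection_pscale _ _ rg) -!(reflection_padd _ _ rg).
  by rewrite (reflection_det3 _ _ _ rg) oppr_eq0.
apply/seteqP; split=> p /=.
  move=> [t /= ts pt]; exists (G t); first by rewrite /= map_f.
  exact: reflection_tetra.
move=> [_ /= /mapP[t ts ->] pt]; exists t => //=; rewrite -(gK p) in pt.
by move: (reflection_tetra rg pt); rewrite /= !gK.
Qed.

Definition chamber : set (pt R) :=
  [set p | 0 <= pz p /\ pz p <= py p /\ py p <= px p].

(** The region on which [S] is known to be polyhedral grows by mirror images, from the chamber to
    the whole space. *)
Lemma polyhedron_chamber S : (forall g p, reflection g -> S p -> S (g p)) ->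
  polyhedron (S `&` chamber) -> polyhedron S.
Proof.
move=> Sg P0.
pose good g := (forall p, S p <-> S (g p)) /\
  forall T, polyhedron T -> polyhedron [set p | T (g p)].
have good_reflection g : reflection g -> good g.
  move=> rg; split=> [p|T]; last exact: polyhedron_reflection.
  by split=> [|/(Sg _ _ rg)]; [exact: Sg|rewrite reflectionK].
have good_comp g g' : good g -> good g' -> good (g \o g').
  move=> [gS gP] [gS' gP']; split=> [p|T /gP/gP']//=.
  by rewrite -gS -gS'.
have step (C C' : set (pt R)) g : good g ->
    (forall x y z : R, C (x, y, z) \/ C (g (x, y, z)) <-> C' (x, y, z)) ->
    polyhedron (S `&` C) -> polyhedron (S `&` C').
  move=> [gS gP] CC' P.
  have -> : S `&` C' = (S `&` C) `|` [set p | (S `&` C) (g p)].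
    apply/seteqP; split=> -[[x y] z] /=.
      by move=> [Sp /CC'[Cp|Cp]]; [left|right; split=> //; rewrite -gS].
    by move=> [[Sp Cp]|[/(gS _).2 Sp Cp]]; split=> //; apply/CC'; [left|right].
  by apply: polyhedron_setU => //; exact: gP.
have gN := good_reflection _ Reflection_negx.
have gX := good_reflection _ Reflection_swapxy.
have gY := good_reflection _ Reflection_swapyz.
have gNy := good_comp _ _ gX (good_comp _ _ gN gX).
have gNz := good_comp _ _ gY (good_comp _ _ gNy gY).
(* Successive regions: x is largest, x or y is largest, the octant; then the sign conditions on x,
   y, z are dropped in turn. *)
have P1 : polyhedron (S `&` [set p | [/\ 0 <= pz p, 0 <= py p, pz p <= px p & py p <= px p]]).
  apply: step gY _ P0 => x y z; rewrite /= /negx /swapxy /swapyz /chamber /px /py /pz /=; split.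
    by move=> [[? [? ?]]|[? [? ?]]]; split; lra.
  by move=> [? ? ? ?]; case: (leP z y) => ?; [left|right]; repeat split; lra.
have P2 : polyhedron (S `&` [set p | [/\ 0 <= px p, 0 <= py p, 0 <= pz p &
    pz p <= px p \/ pz p <= py p]]).
  apply: step gX _ P1 => x y z; rewrite /= /negx /swapxy /swapyz /px /py /pz /=; split.
    by move=> [[? ? ? ?]|[? ? ? ?]]; split; lra.
  by move=> [? ? ? ?]; have [yx|xy] := leP y x; [left|right]; split; lra.
have P3 : polyhedron (S `&` [set p | [/\ 0 <= px p, 0 <= py p & 0 <= pz p]]).
  apply: step gY _ P2 => x y z; rewrite /= /negx /swapxy /swapyz /px /py /pz /=; split.
    by move=> [[]|[]].
  by move=> [? ? ?]; have [yz|zy] := leP y z; [right|left]; split=> //; right; lra.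
have P4 : polyhedron (S `&` [set p | 0 <= py p /\ 0 <= pz p]).
  apply: step gN _ P3 => x y z; rewrite /= /negx /swapxy /swapyz /px /py /pz /=; split.
    by move=> [[]|[]].
  by move=> [? ?]; have [?|?] := leP 0 x; [left|right]; split=> //; lra.
have P5 : polyhedron (S `&` [set p | 0 <= pz p]).
  apply: step gNy _ P4 => x y z; rewrite /= /negx /swapxy /swapyz /px /py /pz /=; split.
    by move=> [[]|[]].
  by move=> ?; have [?|?] := leP 0 y; [left|right]; split=> //; lra.
rewrite -[S]setIT; apply: step gNz _ P5 => x y z; rewrite /= /negx /swapxy /swapyz /px /py /pz /=; split=> // _.
by have [?|?] := leP 0 z; [left|right]; lra.
Qed.

End Polyhedra.

(** * Tetrahedra filling the inflated cube *)

Section InflatedPolyhedron.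
Context {R : realType}.
Implicit Types (p q a b c d : pt R).

Local Notation A := (2 / 5 : R).
Local Notation s := (Num.sqrt 2 : R).
(** [h] is the height of the slabs. The pyramid has rim vertex (A + h, A, A), midpoint (m, m, A) of
    a rim side, and apex (k, k, k). *)
Let h : R := s / 10.
Let m : R := A + h / 2.
Let k : R := A + 2 * h / 3.

(** The bounds are the planes of square, strip and pyramid, with 2 m = 2 A + h and 4 m - A = 3 A + 2
    h. The second alternative may leave z free: for z >= A it implies the third. *)
Lemma inflated_chamberE (x y z : R) : 0 <= z -> z <= y -> y <= x ->
  inflated_cube ((x, y), z) <->
  x <= A + h /\ [\/ y <= A, x + y <= 2 * m | A <= z /\ 2 * x + 2 * y - z <= 4 * m - A].
Proof.
move=> z0 zy yx; rewrite /inflated_cube /= gauge_chamber // /m /h.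
have s0 : 0 < s by rewrite sqrtr_gt0.
have y0 := le_trans z0 zy; have x0 := le_trans y0 yx.
have [xA|Ax] := leP x A.
  rewrite !excess_small ?(le_trans yx) ?(le_trans (le_trans zy yx)) //.
  by split=> _; [split; [lra|apply: Or31; lra]|lra].
rewrite (excess_large (ltW Ax)); have [yA|Ay] := leP y A.
  rewrite !excess_small ?(le_trans zy) //.
  by split=> [?|[? _]]; [split; [lra|exact: Or31]|lra].
rewrite (excess_large (ltW Ay)); have [zA|Az] := leP z A.
  rewrite !excess_small //.
  by split=> [?|[? [?|?|[? ?]]]]; [split; [lra|apply: Or32; lra]|lra..].
rewrite (excess_large (ltW Az)).
by split=> [?|[? [?|?|[? ?]]]]; [split; [lra|apply: Or33; lra]|lra..].
Qed.

(** The weight of the origin takes up the slack 1 - (u + v + w). *)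
Lemma tetra_origin (a b c p : pt R) : tetra ((0, 0), 0) a b c p <->
  exists u v w, [/\ 0 <= u, 0 <= v, 0 <= w & u + v + w <= 1] /\
    p = (((u * px a + v * px b + w * px c, u * py a + v * py b + w * py c),
         u * pz a + v * pz b + w * pz c) : pt R).
Proof.
split=> [[t [u [v [w [[t0 u0 v0 w0 e] ->]]]]]|[u [v [w [[u0 v0 w0 e] ->]]]]].
  exists u, v, w; split; first by split=> //; lra.
  by rewrite /padd /pscale /px /py /pz /=; congr (_, _, _); ring.
exists (1 - (u + v + w)), u, v, w; split; first by split=> //; lra.
by rewrite /padd /pscale /px /py /pz /=; congr (_, _, _); ring.
Qed.

(** Cones from the origin over the surface within the chamber: an eighth of a square, a quarter of a
    strip cut along a diagonal into two triangles, and a sixth of a pyramid. *)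
Definition face_cone : set (pt R) :=
  tetra (0, 0, 0) (A + h, 0, 0) (A + h, A, 0) (A + h, A, A).
Definition strip_cone1 : set (pt R) :=
  tetra (0, 0, 0) (A + h, A, 0) (m, m, 0) (m, m, A).
Definition strip_cone2 : set (pt R) :=
  tetra (0, 0, 0) (A + h, A, 0) (A + h, A, A) (m, m, A).
Definition corner_cone : set (pt R) :=
  tetra (0, 0, 0) (A + h, A, A) (m, m, A) (k, k, k).

Lemma inflated_cube_chamber : inflated_cube `&` chamber =
  face_cone `|` (strip_cone1 `|` (strip_cone2 `|` corner_cone)).
Proof.
have h0 : 0 < h by rewrite divr_gt0 ?sqrtr_gt0.
have hne : h != 0 by rewrite gt_eqF.
have m0 : 0 < m by rewrite /m; lra.
have k0 : 0 < k by rewrite /k; lra.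
have c0 : 0 < A + h by lra.
apply/seteqP; split=> -[[x y] z].
  move=> [Px [z0 [zy yx]]]; rewrite /px /py /pz /= in z0 zy yx.
  have [xc cap] := (inflated_chamberE z0 zy yx).1 Px.
  have y0 := le_trans z0 zy; have x0 := le_trans y0 yx.
  (* The slope y / x decides whether the ray from the origin meets the square. *)
  have [cy|cy] := leP ((A + h) * y) (A * x).
    left; apply/tetra_origin.
    exists (x / (A + h) - y / A), ((y - z) / A), (z / A); rewrite /px /py /pz /=.
    split; last by congr (_, _, _); field; lra.
    split.
    - by rewrite subr_ge0 ler_pdivlMr //; lra.
    - by lra.
    - by lra.
    - have -> : x / (A + h) - y / A + (y - z) / A + z / A = x / (A + h) by field; lra.
      by rewrite ler_pdivrMr // mul1r.
  right.
  (* Coordinates with (x, y) = u (A + h, A) + (t - u) (m, m); the plane of the strip is t = 1. *)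
  pose u := (x - y) / h; have hu : h * u = x - y by rewrite /u mulrC divfK.
  have u0 : 0 <= u by rewrite divr_ge0 ?(ltW h0) // subr_ge0.
  pose t := (x + y) / (2 * m); have mt : 2 * m * t = x + y.
    by rewrite /t mulrC divfK // gt_eqF //; lra.
  have t0 : 0 <= t by rewrite divr_ge0 //; lra.
  have xE : x = (A + h) * u + m * (t - u) by rewrite /m in mt *; lra.
  have yE : y = A * u + m * (t - u) by rewrite /m in mt *; lra.
  have ut : u <= t.
    rewrite -subr_ge0 -(pmulr_rge0 _ m0).
    have H : 0 <= h * (y - A * u) by nra.
    rewrite pmulr_rge0 // in H; lra.
  have t1 : z <= A * t -> t <= 1.
    move=> zt; case: cap => [yA|H|[Az H]].
    - rewrite -(ler_pM2l (_ : 0 < 2 * m)) ?mt; last lra.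
      by rewrite /m; lra.
    - rewrite -(ler_pM2l (_ : 0 < 2 * m)) ?mt; last lra.
      by rewrite mulr1.
    - rewrite -(ler_pM2l (_ : 0 < 4 * m - A)) ?mulr1; last by rewrite /m; lra.
      by rewrite mulrBl; lra.
  (* The plane z = A (t - u) passes through the origin and the diagonal of the strip. *)
  have [zt|zt] := leP z (A * (t - u)).
    left; apply/tetra_origin; exists u, (t - u - z / A), (z / A).
    rewrite /px /py /pz /=; split; last first.
      by rewrite [in LHS]xE [in LHS]yE; congr (_, _, _); field.
    by split=> //; lra.
  (* The plane z = A t passes through the origin and the side of the rim; above it lies the corner
     cone. *)
  right; have [zt'|zt'] := leP z (A * t).
    left; apply/tetra_origin; exists (t - z / A), (z / A - (t - u)), (t - u).
    rewrite /px /py /pz /=; split; last first.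
      by rewrite [in LHS]xE [in LHS]yE; congr (_, _, _); field.
    by split=> //; lra.
  (* Among the three vertices only (m, m, A) has y different from z, by h / 2; the coordinate z then
     gives the weight of the apex. *)
  right; apply/tetra_origin; pose v := 2 * (y - z) / h.
  have hv : h * v = 2 * (y - z) by rewrite /v mulrC divfK.
  pose w := (z - A * (u + v)) / k.
  have kw : k * w = z - A * (u + v) by rewrite /w mulrC divfK // gt_eqF.
  exists u, v, w; rewrite /px /py /pz /=; split; last first.
    by congr (_, _, _); rewrite ?(mulrC w) ?kw /m; lra.
  have v0 : 0 <= v by rewrite divr_ge0 ?(ltW h0) //; lra.
  have w0 : 0 <= w.
    rewrite divr_ge0 ?(ltW k0) //.
    have : 0 <= h * (z - A * (u + v)) by rewrite /m in mt zt'; nra.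
    by rewrite pmulr_rge0.
  split=> //.
  (* The form 2 x + 2 y - z equals 4 m - A at all three vertices, so it measures the total
     weight. *)
  suff : (4 * m - A) * (u + v + w) <= 4 * m - A.
    by rewrite -[leRHS]mulr1 ler_pM2l // /m; lra.
  have -> : (4 * m - A) * (u + v + w) = 2 * x + 2 * y - z.
    by rewrite /m /k in hu hv kw *; lra.
  have tle1 : t <= 1 -> 2 * x + 2 * y - z <= 4 * m - A.
    by rewrite /m in mt *; nra.
  case: cap => [yA|H|[_ //]]; apply: tle1.
    rewrite -(ler_pM2l (_ : 0 < 2 * m)) ?mt; last lra.
    by rewrite /m; lra.
  by rewrite -(ler_pM2l (_ : 0 < 2 * m)) ?mt ?mulr1 //; lra.
have inP x' y' z' : 0 <= z' -> z' <= y' -> y' <= x' -> x' <= A + h ->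
    [\/ y' <= A, x' + y' <= 2 * m | A <= z' /\ 2 * x' + 2 * y' - z' <= 4 * m - A] ->
    (inflated_cube `&` chamber) (x', y', z').
  by move=> *; split; [apply/inflated_chamberE|].
(* Linear arithmetic treats the products with [h] as atoms, so their bounds are supplied here. *)
have H3 u v w : [/\ 0 <= u, 0 <= v, 0 <= w & u + v + w <= 1] ->
    [/\ 0 <= h * u, 0 <= h * v, 0 <= h * w & h * u + h * v + h * w <= h].
  move=> [u0 v0 w0 le1]; split; rewrite ?mulr_ge0 ?(ltW h0) //.
  by rewrite -!mulrDr ger_pMr.
move=> [|[|[|]]] /tetra_origin [u [v [w [uvw ->]]]];
  have [hu hv hw hle] := H3 _ _ _ uvw; case: uvw => u0 v0 w0 le1;
  rewrite /px /py /pz /=; apply: inP; rewrite /k /m; try lra.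
- by apply: Or31; lra.
- by apply: Or32; lra.
- by apply: Or32; lra.
(* The part of the corner cone below z = A satisfies the strip inequality instead. *)
- have [Az|zA] := leP A (u * A + v * A + w * k).
    by rewrite /k in Az; apply: Or33; split; lra.
  by rewrite /k in zA; apply: Or32; lra.
Qed.

Lemma polyhedron_inflated_cube : polyhedron (@inflated_cube R).
Proof.
have h0 : 0 < h by rewrite divr_gt0 ?sqrtr_gt0.
have m0 : 0 < m by rewrite /m; lra.
have k0 : 0 < k by rewrite /k; lra.
have c0 : 0 < A + h by lra.
have nd (a b c : pt R) : det3 a b c != 0 -> nondegenerate ((0, 0), 0) a b c.
  rewrite /nondegenerate; have H (p : pt R) : psub p (0, 0, 0) = p.
    by case: p => [[x y] z]; rewrite /psub /padd /pscale /px /py /pz /= !mulr0 !addr0.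
  by rewrite !H.
apply: polyhedron_chamber.
  by move=> g p rg; rewrite /inflated_cube /= gauge_reflection.
rewrite inflated_cube_chamber; do 3?[apply: polyhedron_setU];
  apply: polyhedron_tetra; apply: nd; rewrite /det3 /px /py /pz /=.
- by rewrite (_ : _ + _ = A * A * (A + h)) ?gt_eqF ?mulr_gt0 //; [lra..|ring].
- by rewrite (_ : _ + _ = A * m * h) ?gt_eqF ?mulr_gt0 //; [lra..|ring].
- by rewrite (_ : _ + _ = - (A * m * h)) ?oppr_eq0 ?gt_eqF ?mulr_gt0 //; [lra..|ring].
- by rewrite (_ : _ + _ = h * k * (h / 2)) ?gt_eqF ?mulr_gt0 //; rewrite /m /k; [lra..|field].
Qed.

End InflatedPolyhedron.

(** * Lower bound for the volume *)

Section Volume.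
Context {R : realType}.

Local Notation lebesgue := (@lebesgue_measure R).
Local Notation A := (2 / 5 : R).
Let h : R := Num.sqrt 2 / 10.

Definition box (I J K : interval R) : set (pt R) := ([set` I] `*` [set` J]) `*` [set` K].

Lemma measurable_box I J K : measurable (box I J K).
Proof. by apply: measurableX => //; exact: measurableX. Qed.

Lemma vol_box I J K :
  vol (box I J K) = (lebesgue [set` I] * lebesgue [set` J] * lebesgue [set` K])%E.
Proof.
rewrite /vol /box product_measure1E //; last exact: measurableX.
by congr (_ * _)%E; exact: product_measure1E.
Qed.

Lemma vol_unit_cube : vol (@unit_cube R) = 1%E.
Proof.
have -> : @unit_cube R = box `[0, 1] `[0, 1] `[0, 1].
  apply/seteqP; split=> p; rewrite /unit_cube /box /= !in_itv /=.
    by move=> [? [? ?]].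
  by move=> [[? ?] ?].
by rewrite vol_box lebesgue_measure_itv /= lte01 oppr0 adde0 !mule1.
Qed.

Lemma measurable_excess : measurable_fun [set: R] (@excess R).
Proof.
apply: measurable_maxr; last exact: measurable_cst.
by apply: measurable_funB; [exact: normr_measurable|exact: measurable_cst].
Qed.

Lemma measurable_inflated_cube : measurable (@inflated_cube R).
Proof.
have mx : measurable_fun [set: pt R] (fun p => excess (px p)).
  apply: measurableT_comp; first exact: measurable_excess.
  by apply: measurableT_comp; exact: measurable_fst.
have my : measurable_fun [set: pt R] (fun p => excess (py p)).
  apply: measurableT_comp; first exact: measurable_excess.
  by apply: measurableT_comp; [exact: measurable_snd|exact: measurable_fst].
have mz : measurable_fun [set: pt R] (fun p => excess (pz p)).
  apply: measurableT_comp; first exact: measurable_excess.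
  exact: measurable_snd.
have mg : measurable_fun [set: pt R] (@gauge R).
  apply: measurable_funB; apply: measurable_funM; try exact: measurable_cst.
    by apply: measurable_funD => //; exact: measurable_funD.
  by apply: measurable_minr => //; exact: measurable_minr.
rewrite -[inflated_cube]setTI; have := mg measurableT `]-oo, Num.sqrt 2 / 5]%classic (measurable_itv _).
by congr measurable; apply/seteqP; split=> p /=; rewrite in_itv.
Qed.

Lemma vol_setU (S T : set (pt R)) : measurable S -> measurable T ->
  S `&` T = set0 -> vol (S `|` T) = (vol S + vol T)%E.
Proof. by move=> mS mT ST; rewrite /vol measureU. Qed.

Lemma le_vol (S T : set (pt R)) : measurable S -> measurable T ->
  S `<=` T -> (vol S <= vol T)%E.
Proof. by move=> mS mT ST; apply: le_measure; rewrite ?inE. Qed.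

Lemma lebesgue_itv (b1 b2 : bool) (x y : R) : x < y ->
  lebesgue [set` Interval (BSide b1 x) (BSide b2 y)] = (y - x)%:E.
Proof. by move=> xy; rewrite lebesgue_measure_itv /= lte_fin xy EFinB. Qed.

Lemma excess_inner (x : R) : - A <= x -> x <= A -> excess x = 0.
Proof. by move=> ? ?; apply/max_idPr; rewrite subr_le0 ler_norml; lra. Qed.

Lemma excess_outer (x : R) : - (A + h) <= x -> x <= A + h -> excess x <= h.
Proof.
have h0 : 0 < h by rewrite divr_gt0 ?sqrtr_gt0.
by move=> ? ?; rewrite ge_max lerBlDl ler_norml; lra.
Qed.

(** [L] and [U] omit the endpoint shared with [M], which makes the boxes of [cross] disjoint. *)
Let M : interval R := `[- A, A].
Let W : interval R := `[- (A + h), A + h].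
Let L : interval R := `[- (A + h), - A[.
Let U : interval R := `]A, A + h].

(* The inner cube together with a slab of height h on each of its faces. *)
Let cross : set (pt R) :=
  box W M M `|` box M L M `|` box M U M `|` box M M L `|` box M M U.

Lemma measurable_cross : measurable cross.
Proof. by rewrite /cross; do 4?[apply: measurableU]; exact: measurable_box. Qed.

(** At most one coordinate leaves [-A, A], so the gauge is at most twice its excess, hence at most 2
    h. *)
Lemma cross_sub : cross `<=` inflated_cube.
Proof.
have h0 : 0 < h by rewrite divr_gt0 ?sqrtr_gt0.
have E : Num.sqrt 2 / 5 = 2 * h by rewrite /h; field.
rewrite /cross /box /M /W /L /U => -[[x y] z] /=; rewrite !in_itv /=.
have zero (u v : R) : 0 <= u -> 0 <= v -> Num.min (Num.min u 0) v = 0.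
  by move=> u0 v0; rewrite (min_idPr u0) (min_idPl v0).
have bound (u v w : R) : 0 <= u -> 0 <= v -> 0 <= w -> u + v + w <= h ->
    2 * (u + v + w) - 3 * Num.min (Num.min u v) w <= 2 * h.
  move=> u0 v0 w0 le_h.
  have : 0 <= Num.min (Num.min u v) w by rewrite !le_min u0 v0.
  lra.
rewrite /inflated_cube /= E /gauge /px /py /pz /=.
move=> [[[[|]|]|]|] [[/andP[? ?] /andP[? ?]] /andP[? ?]]; apply: bound; rewrite ?excess_ge0 //.
- rewrite (excess_inner (x := y)) ?(excess_inner (x := z)) // !addr0.
  exact: excess_outer.
- rewrite (excess_inner (x := x)) ?(excess_inner (x := z)) // addr0 add0r.
  by apply: excess_outer => //; lra.
- rewrite (excess_inner (x := x)) ?(excess_inner (x := z)) // addr0 add0r.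
  by apply: excess_outer => //; lra.
- rewrite (excess_inner (x := x)) ?(excess_inner (x := y)) // !add0r.
  by apply: excess_outer => //; lra.
- rewrite (excess_inner (x := x)) ?(excess_inner (x := y)) // !add0r.
  by apply: excess_outer => //; lra.
Qed.

(** The five disjoint boxes have total volume 64/125 + 96/25 h, which exceeds 1.04 as h > 7/50. *)
Lemma vol_inflated_cube : (1 < vol (@inflated_cube R))%E.
Proof.
have s1 := @sqrt2_gt R.
have h1 : 7 / 50 < h by rewrite /h; lra.
apply: lt_le_trans (le_vol measurable_cross measurable_inflated_cube cross_sub).
have lM : lebesgue [set` M] = (A + A)%:E by rewrite lebesgue_itv ?opprK; [|lra].
have lW : lebesgue [set` W] = (A + h + (A + h))%:E by rewrite lebesgue_itv ?opprK; [|lra].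
have lL : lebesgue [set` L] = h%:E by rewrite lebesgue_itv; [congr EFin; lra|lra].
have lU : lebesgue [set` U] = h%:E by rewrite lebesgue_itv; [congr EFin; lra|lra].
rewrite /cross; rewrite 4?vol_setU.
- rewrite !vol_box lM lW lL lU -!EFinM -!EFinD lte_fin; lra.
all: try by do ?[exact: measurable_box | apply: measurableU].
all: rewrite -subset0 /box /M /W /L /U => -[[x y] z] /=; rewrite !in_itv /=.
- by move=> [[[/andP[? ?] /andP[? ?]] /andP[? ?]] [[/andP[? ?] /andP[? ?]] /andP[? ?]]]; lra.
- by move=> [[|] [[/andP[? ?] /andP[? ?]] /andP[? ?]] [[/andP[? ?] /andP[? ?]] /andP[? ?]]]; lra.
- by move=> [[[|]|] [[/andP[? ?] /andP[? ?]] /andP[? ?]] [[/andP[? ?] /andP[? ?]] /andP[? ?]]]; lra.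
- by move=> [[[[|]|]|] [[/andP[? ?] /andP[? ?]] /andP[? ?]] [[/andP[? ?] /andP[? ?]] /andP[? ?]]]; lra.
Qed.
End Volume.

Theorem mainTheorem1 (R : realType) :
  exists P : set (pt R),
    [/\ polyhedron P, ~ convex3 P,
        intrinsically_isometric (bd (@unit_cube R)) (bd P)
      & (vol (@unit_cube R) < vol P)%E].
Proof.
exists inflated_cube; split.
- exact: polyhedron_inflated_cube.
- exact: inflated_cube_not_convex.
- exact: isometric_inflated_cube.
- by rewrite vol_unit_cube; exact: vol_inflated_cube.
Qed.
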